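(* Let $n\in\mathbb N$. Then the complex space $\ell_1^n$ (that is, $\mathbb C^n$ with the norm $\|(z_i)_{i=1}^n\|=\sum_{i=1}^n|z_i|$) has property (co).
   Context: $B_X$ denotes the closed unit ball of a Banach space $X$, and $B(x,\delta)=\{y\in X:\|y-x\|<\delta\}$. A point $x\in B_X$ has property (co) if for every $m\in\mathbb N$, $m\ge2$, the following holds: whenever $x_1,\dots,x_m\in B_X$ and $\lambda_1,\dots,\lambda_m>0$, $\sum_{j=1}^m\lambda_j=1$, are such that $x=\sum_{j=1}^m\lambda_jx_j$, and $\varepsilon>0$, there is a $\delta>0$ such that, setting $B:=B(x,\delta)\cap B_X$, there are (norm-)continuous functions $\widehat v_j:B\to B_X$, $j\in\{1,\dots,m\}$, such that for every $u\in B$ one has $u=\sum_{j=1}^m\lambda_j\widehat v_j(u)$ and $\|\widehat v_j(u)-x_j\|<\varepsilon$ for every $j\in\{1,\dots,m\}$. The space $X$ has property (co) if every point $x\in B_X$ has property (co). *)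

(* Defs.v *)
From HB Require Import structures.
From mathcomp Require Import all_boot all_order all_algebra.
From mathcomp Require Import all_classical all_reals all_analysis.
From mathcomp Require Import complex.

Set Implicit Arguments.
Unset Strict Implicit.
Unset Printing Implicit Defensive.

Import Order.TTheory GRing.Theory Num.Theory.
Import numFieldNormedType.Exports.

Local Open Scope classical_set_scope.
Local Open Scope ring_scope.

(* An alias is needed because the canonical norm of 'rV[K]_n is the sup norm. *)
Definition ell1 (K : numFieldType) (n : nat) : Type := 'rV[K]_n.

Section Ell1.
Variables (K : numFieldType) (n : nat).

HB.instance Definition _ := GRing.Lmodule.copy (ell1 K n) 'rV[K]_n.

Definition ell1_norm (x : ell1 K n) : K := \sum_(i < n) `|x ord0 i|.

Lemma ell1_normD (x y : ell1 K n) :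
  ell1_norm (x + y) <= ell1_norm x + ell1_norm y.
Proof.
rewrite /ell1_norm -big_split /=.
by apply: ler_sum => i _; rewrite mxE ler_normD.
Qed.

Lemma ell1_normZ (l : K) (x : ell1 K n) :
  ell1_norm (l *: x) = `|l| * ell1_norm x.
Proof.
by rewrite /ell1_norm mulr_sumr; apply: eq_bigr => i _; rewrite mxE normrM.
Qed.

Lemma ell1_norm0_eq0 (x : ell1 K n) : ell1_norm x = 0 -> x = 0.
Proof.
move=> /psumr_eq0P x0; apply/rowP => i; rewrite mxE.
by apply/normr0_eq0/x0.
Qed.

HB.instance Definition _ :=
  Lmodule_isNormed.Build K (ell1 K n) ell1_normD ell1_normZ ell1_norm0_eq0.

Lemma ell1_normE (x : ell1 K n) : `|x| = \sum_(i < n) `|x ord0 i|.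
Proof. by []. Qed.

End Ell1.

Section PropertyCo.
Variables (K : numFieldType) (X : normedModType K).

(* Not the library's [closed_ball], which is the closure of the open ball. *)
Definition unit_ball : set X := [set x | `|x| <= 1].

(* Scalars are compared in K itself. When K = R[i], [0 < a] is the partial
   order of the complex numbers: it says that a is real and positive.
   The maps B -> B_X are total functions on X, constrained only on B. *)
Definition co_point (x : X) : Prop :=
  forall m : nat, (2 <= m)%N ->
  forall (y : 'I_m -> X) (lambda : 'I_m -> K),
    (forall j, unit_ball (y j)) ->
    (forall j, 0 < lambda j) -> \sum_(j < m) lambda j = 1 ->
    x = \sum_(j < m) lambda j *: y j ->
  forall eps : K, 0 < eps ->
  exists2 delta : K, 0 < delta &
    let B := ball x delta `&` unit_ball in
    exists v : 'I_m -> X -> X,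
      [/\ forall j, {within B, continuous (v j)},
          forall j u, B u -> unit_ball (v j u),
          forall u, B u -> u = \sum_(j < m) lambda j *: v j u &
          forall u, B u -> forall j, `|v j u - y j| < eps].

End PropertyCo.

Definition property_co (K : numFieldType) (X : normedModType K) : Prop :=
  forall x : X, unit_ball x -> co_point x.

(* Main.v *)
Require Import Defs.
From mathcomp Require Import all_boot all_order all_algebra.
From mathcomp Require Import all_classical all_reals all_analysis.
From mathcomp Require Import complex.

(** Let [x] be a convex combination of the points [y j] of the unit ball with
    weights [l j].  If [`|x| < 1], translating a slightly contracted copy of
    the [y j] works in every normed space ([co_point_interior]).

    If [`|x| = 1], summing the triangle inequalities
    [`|x i| <= \sum_j l j * `|y j i|] over the coordinates gives
    [1 <= \sum_j l j * `|y j| <= 1], so every one of them is an equality.  Over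
    the complex numbers this forces alignment: [y j i = r j i * x i] with
    [r j i >= 0] and [\sum_j l j * r j i = 1] ([sphere_decomposition_aligned]).
    So the decomposition of [x] hands a share [l j * r j i] of the mass [`|x i|]
    to the index [j], and a nearby [u] has to be shared out in almost the same
    way without giving any [j] more than [l j].  Multiplying [u i] by [r j i] is
    not enough, since mass may have moved towards coordinates where [r j] is
    large.

    The remedy is to transport the surplus of [u] back to where [x] has room.
    Each [u i] is cut radially at modulus [`|x i|] into a core and an excess.
    The core is shared out according to [r j i].  The excess at [i] is
    distributed over the coordinates [k], in proportion to the slack
    [`|x k| - `|core k|], and the part sent to [k] is shared out according to
    [r j k], while it keeps its place [i] and its argument in the complex plane.
    Since [`|u| <= 1 = `|x|], the total slack is at least the total excess, so
    no coordinate [k] receives more than its slack, and the norm of the [j]-th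
    part is at most [\sum_k r j k * `|x k| = `|y j|] ([norm_transport_le]).

    The formula divides by the total slack.  On the unit ball that is also the
    total excess plus [1 - `|u|]; taking [`|1 - `|u| |] instead makes it
    dominate each excess everywhere, and hence [transport] continuous on the
    whole space ([continuous_transport]).  Closeness to [y j] is then
    continuity at [x], where the excess vanishes ([transport_id]). *)

Set Implicit Arguments.
Unset Strict Implicit.
Unset Printing Implicit Defensive.

Import Order.TTheory GRing.Theory Num.Theory.
Import numFieldNormedType.Exports.

Local Open Scope classical_set_scope.
Local Open Scope ring_scope.

(** * Points of norm less than one *)

(** Moving every [y j] towards [x] by a factor [t] brings it to norm at most
    [1 - t * (1 - `|x|)], which leaves room for the translation by [u - x]. *)
Lemma co_point_interior (K : numFieldType) (X : normedModType K) (x : X) :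
  `|x| < 1 -> co_point x.
Proof.
move=> x1 m _ y l y1 l0 suml xE eps eps0.
have [t [t0 t1 t3]] : exists t, [/\ 0 < t, t <= 1 & t * 3 < eps].
  (* An explicit stand-in for the minimum of 1 and eps / 3; the total
     displacement below is at most t * 2 + t. *)
  have eps3 : 0 < eps + 3 by rewrite addr_gt0.
  exists (eps / (eps + 3)); split; first by rewrite divr_gt0.
    by rewrite ler_pdivrMr// mul1r lerDl.
  by rewrite mulrAC -mulrA gtr_pMr// ltr_pdivrMr// mul1r ltrDr.
exists (t * (1 - `|x|)); first by rewrite mulr_gt0// subr_gt0.
move=> B; exists (fun j u => (1 - t) *: y j + t *: x + (u - x)).
have Bux u : B u -> `|u - x| < t * (1 - `|x|).
  by case=> + _; rewrite -ball_normE /= distrC.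
split => [j|j u /Bux ux|u /Bux _|u /Bux ux j].
- apply: continuous_subspaceT => u.
  apply: cvgD; first exact: cvg_cst.
  by apply: cvgB; [exact: cvg_id | exact: cvg_cst].
- rewrite /unit_ball /=.
  apply: (le_trans (ler_normD _ _)).
  apply: (le_trans (lerD (ler_normD _ _) (ltW ux))).
  rewrite !normrZ (ger0_norm (ltW t0)) ger0_norm ?subr_ge0//.
  rewrite -addrA -mulrDr (addrC `|x|) subrK mulr1 -lerBrDr.
  by rewrite -[leRHS]mulr1 ler_wpM2l ?subr_ge0//; exact: y1.
- under eq_bigr do rewrite !scalerDr.
  rewrite !big_split /= -!scaler_suml suml !scale1r.
  under eq_bigr do rewrite scalerA mulrC -scalerA.
  by rewrite -scaler_sumr -xE -scalerDl subrK scale1r addrC subrK.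
- apply: le_lt_trans t3.
  have -> : (1 - t) *: y j + t *: x + (u - x) - y j = t *: (x - y j) + (u - x).
    rewrite scalerBl scale1r scalerBr addrAC; congr (_ + _).
    by rewrite -(addrA (y j)) addrC addKr addrC.
  apply: (le_trans (ler_normD _ _)).
  rewrite normrZ (gtr0_norm t0) (natrD _ 2 1) mulrDr mulr1 lerD//.
    rewrite ler_pM2l//; apply: (le_trans (ler_normB _ _)).
    by rewrite lerD//; [exact: ltW | exact: y1].
  by apply: (le_trans (ltW ux)); rewrite ger_pMr// gerBl.
Qed.

(** * Continuity tools *)

(** Where [d] vanishes the ratio has no limit in general, but it stays bounded
    by one, and [g] tends to zero there. *)
Lemma continuous_mul_ratio {T : topologicalType} {K : numFieldType}
    (g e d : T -> K) :
  continuous g -> continuous e -> continuous d ->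
  (forall u, `|e u| <= d u) -> (forall u, d u = 0 -> g u = 0) ->
  continuous (fun u => g u * (e u / d u)).
Proof.
move=> cg ce cd ed dg u; have [du0|du0] := eqVneq (d u) 0; last first.
  apply: cvgM; first exact: cg.
  by apply: cvgM; [exact: ce | apply: cvgV => //; exact: cd].
rewrite /continuous_at (dg u du0) mul0r.
have := cg u; rewrite /continuous_at (dg u du0) => /cvgrPdist_lt g0.
apply/cvgrPdist_lt => eps /g0; apply: filterS => v; rewrite !sub0r !normrN.
apply: le_lt_trans; rewrite normrM ler_piMr// normf_div.
have d0 : 0 <= d v by exact: le_trans (ed v).
rewrite (ger0_norm d0); have [->|dv0] := eqVneq (d v) 0.
  by rewrite invr0 mulr0.
by rewrite ler_pdivrMr ?mul1r// lt_def dv0.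
Qed.

(** * Radial truncation *)

(** Like the nearest-point retraction onto the disc of radius [p], this shrinks
    [z] towards 0 into that disc and fixes the circle of radius [p], but it
    avoids maxima, which behave badly over a partially ordered field: the
    denominator dominates both [p] and [`|z|].  When [p = 0] it is the zero
    map. *)
Definition radial_trunc {K : numFieldType} (p z : K) : K :=
  p / (p + `| `|z| - p |) * z.

Section RadialTrunc.
Context {K : numFieldType} (p : K).
Hypothesis p0 : 0 <= p.
Implicit Type z : K.

Let factor z := p / (p + `| `|z| - p |).

Let factor_ge0 z : 0 <= factor z.
Proof. by rewrite divr_ge0// addr_ge0. Qed.

Let factor_le1 z : factor z <= 1.
Proof.
have := p0; rewrite /factor le_eqVlt => /orP[/eqP<-|pp]; first by rewrite mul0r.
by rewrite ler_pdivrMr ?ltr_wpDr// mul1r lerDl.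
Qed.

Lemma norm_radial_trunc_le z : `|radial_trunc p z| <= p.
Proof.
rewrite /radial_trunc normrM (ger0_norm (factor_ge0 z)) /factor.
have := p0; rewrite le_eqVlt => /orP[/eqP<-|pp]; first by rewrite !mul0r.
rewrite mulrAC ler_pdivrMr ?ltr_wpDr// ler_pM2l//.
by rewrite -lerBlDl real_ler_norm// realB ?ger0_real.
Qed.

(** The truncation is a multiple of [z] by a factor between 0 and 1, so cutting
    it off leaves no slack in the triangle inequality. *)
Lemma norm_radial_trunc_compl z :
  `|radial_trunc p z| + `|z - radial_trunc p z| = `|z|.
Proof.
have := factor_ge0 z; have := factor_le1 z.
rewrite /radial_trunc -/(factor z); move: (factor z) => s s1 s0.
rewrite -{2}[z]mul1r -mulrBl !normrM (ger0_norm s0).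
rewrite (@ger0_norm _ (1 - s)) ?subr_ge0//.
by rewrite -mulrDl (addrC s) subrK mul1r.
Qed.

Lemma radial_trunc_id z : `|z| = p -> radial_trunc p z = z.
Proof.
rewrite /radial_trunc => zp; rewrite zp subrr normr0 addr0.
have [p_eq0|pn0] := eqVneq p 0; last by rewrite divff// mul1r.
by move/eqP: zp; rewrite p_eq0 normr_eq0 => /eqP->; rewrite mulr0.
Qed.

Lemma continuous_radial_trunc : continuous (radial_trunc p).
Proof.
move=> z; rewrite /radial_trunc.
have := p0; rewrite le_eqVlt => /orP[/eqP<-|pp].
  under eq_fun do rewrite !mul0r.
  exact: cst_continuous.
have FF := @nbhs_filter K z.
apply: (cvgM (FF := FF)); last exact: cvg_id.
apply: (cvgM (FF := FF)); first exact: cvg_cst.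
apply: (cvgV (FF := FF)); first by rewrite gt_eqF// ltr_wpDr.
apply: (cvgD (FF := FF)); first exact: cvg_cst.
apply: (cvg_norm (FF := FF)); apply: (cvgB (FF := FF)); last exact: cvg_cst.
by apply: (cvg_norm (FF := FF)); exact: cvg_id.
Qed.

End RadialTrunc.

(** * Coordinates and continuity in the ell1 norm *)

Lemma continuous_coord (K : numFieldType) n (i : 'I_n) :
  continuous (fun u : ell1 K n => u ord0 i).
Proof.
move=> u; apply/(cvgrPdist_lt (FF := nbhs_filter u)) => eps eps0.
apply/nbhs_ballP; exists eps => // v; rewrite -ball_normE /=.
apply: le_lt_trans; rewrite ell1_normE (bigD1 i)//= !mxE lerDl.
by apply: sumr_ge0.
Qed.

Lemma continuous_ell1 (K : numFieldType) n (T : topologicalType)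
    (f : T -> ell1 K n) :
  (forall i, continuous (fun u => f u ord0 i)) -> continuous f.
Proof.
move=> cf.
have -> : f = fun u => \sum_(i < n) f u ord0 i *: (delta_mx 0 i : ell1 K n).
  by apply/funext => u; exact: row_sum_delta.
apply: continuous_big; first exact: add_continuous.
by move=> i _ u; apply: cvgZ; [exact: cf | exact: cvg_cst].
Qed.

(** * Alignment of convex decompositions on the sphere *)

(** Equality in the triangle inequality makes all [l j * y j] nonnegative
    multiples of one unit [t], and then so is their sum.  If the sum is zero,
    all the [y j] vanish and the ratios are free; the constant 1 has the right
    average. *)
Lemma norm_sum_eq_nonneg_ratio {C : numClosedFieldType} {I : finType}
    (l y : I -> C) :
  (forall j, 0 < l j) -> \sum_j l j = 1 ->
  `|\sum_j l j * y j| = \sum_j l j * `|y j| ->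
  exists r : I -> C, [/\ forall j, 0 <= r j, \sum_j l j * r j = 1 &
    forall j, y j = r j * \sum_k l k * y k].
Proof.
move=> l0 suml; set x := \sum_j _ => xE.
have nly j : `|l j * y j| = l j * `|y j| by rewrite normrM gtr0_norm.
have [x0|x0] := eqVneq x 0.
  exists (fun=> 1); split => [//||j]; first by under eq_bigr do rewrite mulr1.
  rewrite x0 mul1r; apply/normr0_eq0.
  move: xE; rewrite x0 normr0 => /esym/psumr_eq0P => /(_ _ j isT)/eqP.
  rewrite mulf_eq0 gt_eqF//= => /(_ _)/eqP; apply => k _.
  by rewrite mulr_ge0// ltW.
have [t _ yt] : {t : C | `|t| == 1 &
    forall j, true -> l j * y j = `|l j * y j| * t}.
  by apply: normC_sum_eq; rewrite xE; apply: eq_bigr => j _.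
have xt : x = `|x| * t.
  by rewrite xE mulr_suml; apply: eq_bigr => j _; rewrite yt// nly.
exists (fun j => `|y j| / `|x|); split => [j||j].
- by rewrite divr_ge0.
- under eq_bigr do rewrite mulrA.
  by rewrite -mulr_suml -xE divff// normr_eq0.
- rewrite [X in _ * X]xt mulrA divfK ?normr_eq0//.
  apply: (mulfI (lt0r_neq0 (l0 j))).
  by rewrite yt// nly mulrA.
Qed.

(** * Transporting the surplus mass *)

Section Sphere.
Context {K : numFieldType} {n : nat} (x : ell1 K n).
Implicit Types (u : ell1 K n) (i : 'I_n) (r : 'I_n -> K).

Definition core i u : K := radial_trunc `|x ord0 i| (u ord0 i).
Definition excess i u : K := u ord0 i - core i u.
Definition slack i u : K := `|x ord0 i| - `|core i u|.

(** On the unit ball this is the sum of the slacks when [`|x| = 1], see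
    [total_slackE].  In this form it dominates every excess on the whole
    space. *)
Definition total_slack u : K := \sum_(i < n) `|excess i u| + `|1 - `|u| |.

(** The share of [u] that goes with the density [r] relative to [x].  The excess
    at [i] is spread over the coordinates [k] with the weights
    [slack k u / total_slack u], so its factor is the average of [r] for these
    weights.  When the total slack is zero every excess is zero as well, and the
    convention [0 / 0 = 0] gives the right value. *)
Definition transport r u : ell1 K n :=
  \row_i (r i * core i u
          + (\sum_(k < n) r k * slack k u) * (excess i u / total_slack u)).

Lemma slack_ge0 i u : 0 <= slack i u.
Proof. by rewrite subr_ge0 norm_radial_trunc_le. Qed.

Lemma excess_le_total_slack i u : `|excess i u| <= total_slack u.
Proof.
rewrite /total_slack (bigD1 i)//= -addrA lerDl addr_ge0//.
exact: sumr_ge0.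
Qed.

Hypothesis x1 : `|x| = 1.

(** Both sides are [1 - \sum_i `|core i u|]: the moduli of the cores and of the
    excesses add up to [`|u|], and the slacks complete the cores to [`|x|]. *)
Lemma total_slackE u : `|u| <= 1 -> total_slack u = \sum_(i < n) slack i u.
Proof.
move=> u1; rewrite /total_slack ger0_norm ?subr_ge0//.
rewrite /slack sumrB -[in RHS]ell1_normE x1 addrCA; congr (1 + _).
rewrite ell1_normE -opprB; congr (- _); rewrite -sumrB.
apply: eq_bigr => i _.
by rewrite -(@norm_radial_trunc_compl _ `|x ord0 i|) ?addrK.
Qed.

(** A vanishing total slack forces [`|u| = 1], so [u] lies in the unit ball,
    where the total slack is the sum of the nonnegative slacks. *)
Lemma total_slack_eq0 u : total_slack u = 0 ->
  (forall i, excess i u = 0) /\ (forall i, slack i u = 0).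
Proof.
move=> T0; have /eqP := T0.
rewrite paddr_eq0 ?sumr_ge0// => /andP[e0].
rewrite normr_eq0 subr_eq0 => /eqP u1.
split=> i.
  by apply/normr0_eq0; move/eqP/psumr_eq0P : e0; exact.
have := T0; rewrite total_slackE -?u1// => /psumr_eq0P; apply => // k _.
exact: slack_ge0.
Qed.

Lemma continuous_core i : continuous (core i).
Proof.
move=> u; apply: (cvg_comp (fun u => u ord0 i) (radial_trunc _)).
  exact: continuous_coord.
exact: continuous_radial_trunc.
Qed.

Lemma continuous_excess i : continuous (excess i).
Proof.
move=> u; apply: (cvgB (FF := nbhs_filter u)); first exact: continuous_coord.
exact: continuous_core.
Qed.

Lemma continuous_slack i : continuous (slack i).
Proof.
move=> u; apply: (cvgB (FF := nbhs_filter u)); first exact: cvg_cst.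
by apply: (cvg_norm (FF := nbhs_filter u)); exact: continuous_core.
Qed.

Lemma continuous_total_slack : continuous total_slack.
Proof.
move=> u; apply: (cvgD (FF := nbhs_filter u)).
  apply: continuous_big; first exact: add_continuous.
  move=> k _ v; apply: (cvg_norm (FF := nbhs_filter v)).
  exact: continuous_excess.
apply: (cvg_norm (FF := nbhs_filter u)).
apply: (cvgB (FF := nbhs_filter u)); first exact: cvg_cst.
exact: norm_continuous.
Qed.

Lemma continuous_transport r : continuous (transport r).
Proof.
apply: continuous_ell1 => i; under eq_fun do rewrite mxE.
move=> u; apply: (cvgD (FF := nbhs_filter u)).
  apply: (cvgM (FF := nbhs_filter u)); first exact: cvg_cst.
  exact: continuous_core.
apply: (@continuous_mul_ratio _ _ (fun u => \sum_(k < n) r k * slack k u)).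
- apply: continuous_big; first exact: add_continuous.
  move=> k _ v; apply: (cvgM (FF := nbhs_filter v)); first exact: cvg_cst.
  exact: continuous_slack.
- exact: continuous_excess.
- exact: continuous_total_slack.
- by move=> v; exact: excess_le_total_slack.
- by move=> v /total_slack_eq0[_ s0]; apply: big1 => k _; rewrite s0 mulr0.
Qed.

Lemma transport_id r : transport r x = \row_i (r i * x ord0 i).
Proof.
apply/rowP => i; rewrite !mxE /excess /core radial_trunc_id//.
by rewrite subrr mul0r mulr0 addr0.
Qed.

(** Together the excesses weigh at most the total slack, so they contribute at
    most [\sum_k r k * slack k u], which is exactly what the cores leave free in
    [\sum_k r k * `|x k|]. *)
Lemma norm_transport_le r u : (forall i, 0 <= r i) ->
  `|transport r u| <= \sum_(i < n) r i * `|x ord0 i|.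
Proof.
move=> r0; rewrite ell1_normE.
set q := \sum_(k < n) r k * slack k u.
have q0 : 0 <= q by apply: sumr_ge0 => k _; rewrite mulr_ge0// slack_ge0.
have T0 : 0 <= total_slack u by rewrite addr_ge0// sumr_ge0.
have -> : \sum_(i < n) r i * `|x ord0 i| = \sum_(i < n) r i * `|core i u| + q.
  by rewrite -big_split; apply: eq_bigr => i _ /=; rewrite -mulrDr addrC subrK.
apply: (@le_trans _ _ (\sum_(i < n)
    (r i * `|core i u| + q * (`|excess i u| / total_slack u)))).
  apply: ler_sum => i _; rewrite mxE -/q (le_trans (ler_normD _ _))//.
  rewrite (normrM (r i)) (normrM q) normf_div.
  by rewrite (ger0_norm (r0 i)) (ger0_norm q0) (ger0_norm T0).
rewrite big_split /= lerD2l -mulr_sumr ler_piMr// -mulr_suml.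
have [->|Tn0] := eqVneq (total_slack u) 0; first by rewrite invr0 mulr0.
by rewrite ler_pdivrMr ?lt_def ?Tn0// mul1r lerDl.
Qed.

(** Averaging over [j] turns every [r j i] into 1.  Then the weights that spread
    the excess add up to 1 on the unit ball, and core and excess add up to
    [u]. *)
Lemma transport_average (m : nat) (l : 'I_m -> K) (r : 'I_m -> 'I_n -> K) u :
  (forall i, \sum_(j < m) l j * r j i = 1) -> `|u| <= 1 ->
  \sum_(j < m) l j *: transport (r j) u = u.
Proof.
move=> lr u1; apply/rowP => i; rewrite summxE.
under eq_bigr do rewrite !mxE mulrDr !mulrA.
rewrite big_split /= -!mulr_suml lr mul1r.
have -> : \sum_(j < m) l j * (\sum_(k < n) r j k * slack k u) = total_slack u.
  under eq_bigr do rewrite mulr_sumr.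
  rewrite exchange_big total_slackE//=; apply: eq_bigr => k _.
  by under eq_bigr do rewrite mulrA; rewrite -mulr_suml lr mul1r.
have [T0|T0] := eqVneq (total_slack u) 0.
  by rewrite T0 !mul0r addr0; apply/esym/subr0_eq/(total_slack_eq0 T0).1.
by rewrite (mulrAC (total_slack u)) divff// mul1r addrC subrK.
Qed.

End Sphere.

(** * Property (co) for the complex ell1 space *)

(** The coordinatewise defects in the triangle inequality are nonnegative, and
    they sum to at most [1 - 1 = 0] because each [y j] has norm at most 1. *)
Lemma sphere_decomposition_aligned (C : numClosedFieldType) (n m : nat)
    (y : 'I_m -> ell1 C n) (l : 'I_m -> C) (x : ell1 C n) :
  `|x| = 1 -> (forall j, `|y j| <= 1) ->
  (forall j, 0 < l j) -> \sum_(j < m) l j = 1 -> x = \sum_(j < m) l j *: y j ->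
  exists r : 'I_m -> 'I_n -> C, [/\ forall j i, 0 <= r j i,
    forall i, \sum_(j < m) l j * r j i = 1 &
    forall j i, y j ord0 i = r j i * x ord0 i].
Proof.
move=> x1 y1 l0 suml xE.
have xiE i : x ord0 i = \sum_(j < m) l j * y j ord0 i.
  by rewrite xE summxE; apply: eq_bigr => j _; rewrite mxE.
have defect_ge0 i : 0 <= \sum_(j < m) l j * `|y j ord0 i| - `|x ord0 i|.
  rewrite subr_ge0 xiE (le_trans (ler_norm_sum _ _ _))// ler_sum// => j _.
  by rewrite normrM gtr0_norm.
have sum_defect :
    \sum_(i < n) (\sum_(j < m) l j * `|y j ord0 i| - `|x ord0 i|) = 0.
  apply/eqP; rewrite eq_le sumr_ge0 ?andbT; last first.
    by move=> i _; exact: defect_ge0.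
  rewrite sumrB -ell1_normE x1 subr_le0 exchange_big -suml ler_sum//= => j _.
  by rewrite -mulr_sumr -ell1_normE ler_piMr// ltW.
have aligned i : exists r : 'I_m -> C, [/\ forall j, 0 <= r j,
    \sum_j l j * r j = 1 & forall j, y j ord0 i = r j * x ord0 i].
  rewrite xiE; apply: norm_sum_eq_nonneg_ratio => //; rewrite -xiE.
  apply/esym/eqP; rewrite -subr_eq0; apply/eqP.
  by move/psumr_eq0P : sum_defect; apply.
have [r rP] := choice aligned.
by exists (fun j i => r i j); split=> [j i|i|j i]; case: (rP i).
Qed.

Lemma co_point_ell1_sphere (C : numClosedFieldType) (n : nat) (x : ell1 C n) :
  `|x| = 1 -> co_point x.
Proof.
move=> x1 m _ y l y1 l0 suml xE eps eps0.
have [r [r0 lr yr]] := sphere_decomposition_aligned x1 y1 l0 suml xE.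
have tx j : transport x (r j) x = y j.
  by rewrite transport_id; apply/rowP => i; rewrite mxE yr.
have : \forall u \near x, forall j, `|y j - transport x (r j) u| < eps.
  apply: (filter_forall (nbhs_filter x)) => j; rewrite -tx.
  apply: (cvgrPdist_lt (FF := nbhs_filter x) _ _).1 => //.
  exact: continuous_transport.
move=> /nbhs_ballP[delta delta0 close].
exists delta => // B; exists (fun j => transport x (r j)); split.
- by move=> j; apply: continuous_subspaceT; exact: continuous_transport.
- move=> j u _.
  apply: (le_trans (norm_transport_le x u (r0 j))).
  apply: (le_trans _ (y1 j)); rewrite ell1_normE ler_sum// => i _.
  by rewrite yr normrM (ger0_norm (r0 j i)).
- by move=> u [_ u1]; rewrite (transport_average x1 lr u1).
- by move=> u [xu _] j; rewrite distrC; exact: close.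
Qed.

Theorem theorem3p8 (R : realType) (n : nat) : property_co (ell1 R[i] n).
Proof.
move=> x; rewrite /unit_ball /= le_eqVlt => /orP[/eqP x1|x1].
  exact: co_point_ell1_sphere.
exact: co_point_interior.
Qed.
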